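(* Let $k\ge 1$ and $n$ be integers with $n>k+1$. Then $$\left|A_k(n)-C_k\,f_k(n)\,\frac{n^{k}}{k!}\right|\le \frac{2+e}{\sqrt{2\pi k}}\,(e^2\log n)^{k}\,n^{k-1}.$$
   Context: $\mathbb{N}$ denotes the positive integers, $p$ always denotes a prime, and $\log$ is the natural logarithm. For positive integers $k,n$: $A_k(n)$ is the number of tuples $(x,y_1,\dots,y_k)\in\mathbb{N}^{k+1}$ with $n=x+y_1+\cdots+y_k$ and $\gcd(x,y_1\cdots y_k)=1$. $\psi_k(x)=\dfrac{x^k-(x-1)^k+(-1)^k}{x}$. $C_k=\prod_{p}\left(1-\dfrac{\psi_k(p)}{p^k}\right)$, the product being over all primes $p$. $f_k(n)=\prod_{p\mid n}\left(1+\dfrac{(-1)^k}{p^k-\psi_k(p)}\right)$, the product being over the primes $p$ dividing $n$. *)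

(* Defs.v *)
From mathcomp Require Import all_boot all_order all_algebra.
From mathcomp Require Import all_classical all_reals all_analysis.
From mathcomp Require Import lra.
Import Order.TTheory GRing.Theory Num.Theory.
Import numFieldNormedType.Exports.

Set Implicit Arguments.
Unset Strict Implicit.
Unset Printing Implicit Defensive.

(* The entries of a tuple of positive integers with sum n are at most n, so
   letting them range over 'I_n.+1 loses no tuple. *)
Definition A (k n : nat) : nat :=
  #|[set t : 'I_n.+1 * {ffun 'I_k -> 'I_n.+1} |
     [&& 0 < t.1, [forall i, 0 < t.2 i],
         n == t.1 + \sum_(i < k) t.2 i
       & coprime t.1 (\prod_(i < k) t.2 i)]]|.

Local Open Scope classical_set_scope.
Local Open Scope ring_scope.

Definition psi {R : realType} (k : nat) (x : R) : R :=
  (x ^+ k - (x - 1) ^+ k + (-1) ^+ k) / x.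

Definition Cpartial {R : realType} (k N : nat) : R :=
  \prod_(0 <= p < N | prime p) (1 - psi k p%:R / p%:R ^+ k).

(* [lim] is total; [Cpartial_is_cvg] shows that the limit exists. *)
Definition C {R : realType} (k : nat) : R :=
  lim (Cpartial k N @[N --> \oo]).

Definition f {R : realType} (k n : nat) : R :=
  \prod_(p <- primes n) (1 + (-1) ^+ k / (p%:R ^+ k - psi k p%:R)).

Lemma Cfactor_itv {R : realType} (k p : nat) : prime p ->
  0 <= 1 - psi k p%:R / (p%:R : R) ^+ k <= 1.
Proof.
move=> pp.
have x2 : 2 <= p%:R :> R by rewrite ler_nat prime_gt1.
move: (p%:R : R) x2 => x x2.
have x0 : 0 < x by lra.
have xk0 : 0 < x ^+ k by rewrite exprn_gt0.
have y1 : 1 <= (x - 1) ^+ k by apply: exprn_ege1; lra.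
have s1 : (-1) ^+ k <= 1 :> R.
  by rewrite -signr_odd; case: (odd k); rewrite ?expr1 ?expr0; lra.
have num0 : 0 <= x ^+ k - (x - 1) ^+ k + (-1) ^+ k.
  case: k {xk0 s1} y1 => [|k] y1; first by rewrite !expr0; lra.
  have sN1 : -1 <= (-1) ^+ k.+1 :> R.
    by rewrite -signr_odd; case: (odd _); rewrite ?expr1 ?expr0; lra.
  have h : (x - 1) ^+ k <= x ^+ k by rewrite lerXn2r ?nnegrE; lra.
  have h1 : 1 <= x ^+ k by apply: exprn_ege1; lra.
  rewrite !exprS in y1 sN1 *.
  nra.
rewrite lerBlDr lerDl subr_ge0 ler_pdivrMr // mul1r /psi.
rewrite ler_pdivrMr // !divr_ge0 ?andbT ?(ltW xk0) ?(ltW x0) //.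
nra.
Qed.

Lemma Cpartial_is_cvg {R : realType} (k : nat) :
  cvgn (Cpartial k : nat -> R).
Proof.
have C0 N : 0 <= Cpartial k N :> R.
  by apply: prodr_ge0 => p /(@Cfactor_itv R k) /andP[].
apply: nonincreasing_is_cvgn; last by exists 0 => _ [N _ <-].
apply/nonincreasing_seqP => N.
rewrite /Cpartial big_mkcond (big_nat_recr N) //= -big_mkcond.
case: ifPn => [pN|_]; last by rewrite mulr1.
by rewrite ler_piMr //; [exact: C0 | case/andP: (@Cfactor_itv R k N pN)].
Qed.

(* Main.v *)
(** For a squarefree d let W(d) be the number of tuples with sum n, d | x and
    d | y_1 ... y_k, and let G(d) be the number of residue vectors r mod d with
    r_1 + ... + r_k = n and r_1 ... r_k = 0.  Sieving by the primes below
    N > n gives A_k(n) = sum_d mu(d) W(d), over the d composed of such primes.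
    Fixing the residues of the y_i leaves a stars-and-bars count, so
    W(d) = G(d) (n/d)^k / k! up to an error G(d) (k^k / k!) (n/d)^(k-1+s), for
    any s in [0,1]; the exponent s (Rankin's trick) covers the d > n, where
    W(d) = 0, together with the d <= n.  G is multiplicative,
    G(p) = psi_k(p) - (-1)^k [p | n], and G(p) <= k p^(k-2) for k >= 2, so the
    main terms add up to C_k f_k(n) n^k / k! as N grows, and the errors to at
    most
      (k^k / k!) n^(k-1+s) prod_p (1 + k p^(-1-s))
        <= (k^k / k!) n^(k-1+s) (1 + 1/s)^k;
    take s = 1 / log n.  For k = 1 the error term vanishes: A_1(n) = phi(n). *)
Require Import Defs.
From mathcomp Require Import all_boot all_order all_algebra.
From mathcomp Require Import all_classical all_reals all_analysis.
From mathcomp Require Import zify ring lra.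
Import Order.TTheory GRing.Theory Num.Theory.
Import numFieldNormedType.Exports.

Set Implicit Arguments.
Unset Strict Implicit.
Unset Printing Implicit Defensive.

(** * Stars and bars over the residue classes modulo d *)

(* Residues mod [d] are represented by [r i + 1] in 1..d, so that a positive
   [y i] is [q * d + r i + 1] with [q] an arbitrary natural number. *)
Definition residues (k d n : nat) : {set {ffun 'I_k -> 'I_d}} :=
  [set r : {ffun 'I_k -> 'I_d} |
    (d %| \prod_(i < k) (r i).+1) && (\sum_(i < k) (r i).+1 == n %[mod d])].

(** W(d) of the overview, with x eliminated as n minus the sum of the y_i. The strict bound on that
    sum makes x positive and the truncated subtraction exact. *)
Definition divisible_sols (k n d : nat) : {set {ffun 'I_k -> 'I_n.+1}} :=
  [set y : {ffun 'I_k -> 'I_n.+1} |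
    [&& [forall i, 0 < y i], \sum_(i < k) y i < n,
        d %| n - \sum_(i < k) y i & d %| \prod_(i < k) y i]].

Lemma eqn_modS (d a b : nat) : a = b %[mod d] -> a.+1 = b.+1 %[mod d].
Proof. by move=> ab; rewrite -addn1 -modnDml ab modnDml addn1. Qed.

Lemma eq_modn_sum (I : finType) (F G : I -> nat) (d : nat) :
  (forall i, F i = G i %[mod d]) -> \sum_i F i = \sum_i G i %[mod d].
Proof.
move=> FG; elim/big_rec2: _ => // i a b _ ab.
by rewrite -modnDm FG ab modnDm.
Qed.

Lemma eq_modn_prod (I : finType) (F G : I -> nat) (d : nat) :
  (forall i, F i = G i %[mod d]) -> \prod_i F i = \prod_i G i %[mod d].
Proof.
move=> FG; elim/big_rec2: _ => // i a b _ ab.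
by rewrite -modnMm FG ab modnMm.
Qed.

(* When no solution lies above [r], the truncated subtraction makes the
   binomial coefficient ['C(k.-1, k)], which is 0. *)
Lemma card_fiber (k n d : nat) (d0 : 0 < d) (r : {ffun 'I_k -> 'I_d}) :
  0 < k -> r \in residues k d n ->
  #|[set y in divisible_sols k n d |
      [ffun i => Ordinal (ltn_pmod (y i).-1 d0)] == r]|
  = 'C(((n - \sum_(i < k) (r i).+1) %/ d + k).-1, k).
Proof.
move=> k0; rewrite inE => /andP[rprod rsum].
set s := \sum_(i < k) (r i).+1.
have yE (y : {ffun 'I_k -> 'I_n.+1}) : y \in divisible_sols k n d ->
    [ffun i => Ordinal (ltn_pmod (y i).-1 d0)] == r ->
    forall i, y i = (y i).-1 %/ d * d + (r i).+1 :> nat.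
  rewrite inE => /and4P[/forallP y0 _ _ _] /eqP/ffunP yr i.
  have := congr1 val (yr i); rewrite ffunE /= => <-.
  by rewrite addnS -divn_eq prednK.
have sumE (q : 'I_k -> nat) :
    \sum_(i < k) (q i * d + (r i).+1) = (\sum_i q i) * d + s.
  by rewrite big_split /= big_distrl.
case: (leqP n s) => [ns|sn].
  have -> : n - s = 0 by apply/eqP; rewrite subn_eq0.
  rewrite div0n add0n bin_small ?prednK //.
  apply/eqP; rewrite cards_eq0; apply/eqP/setP => y; rewrite finset.in_set0 inE.
  apply/negP => /andP[yS yr]; have {}yr := yE y yS yr.
  move: yS; rewrite inE => /and4P[_ + _ _].
  under eq_bigr => i _ do rewrite yr.
  rewrite sumE; lia.
have dns : d %| n - s by rewrite -eqn_mod_dvd ?(ltnW sn) // eq_sym.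
have nE : n = (n - s) %/ d * d + s by rewrite divnK // subnK // ltnW.
have : 0 < (n - s) %/ d by rewrite divn_gt0 // dvdn_leq // subn_gt0.
move: nE; case: ((n - s) %/ d) => // M nE _.
(* The quotient is M + 1 and x = (M + 1 - sum of q) d, so x > 0 means that q has sum at most M; such
   q are counted by stars and bars. *)
rewrite addSn /= addnC -card_partial_ord_partitions.
(* When q has sum at most M, each entry is at most the total, hence at most n, so [inord] keeps its
   value. *)
pose phi (q : k.-tuple 'I_M.+1) : {ffun 'I_k -> 'I_n.+1} :=
  [ffun i => inord (tnth q i * d + (r i).+1)].
have qsum (q : k.-tuple 'I_M.+1) : \sum_(i <- q) i = \sum_(i < k) tnth q i.
  by rewrite big_tuple.
have phiE (q : k.-tuple 'I_M.+1) : \sum_(i <- q) i <= M ->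
    forall i, phi q i = tnth q i * d + (r i).+1 :> nat.
  rewrite qsum => qM i; rewrite ffunE inordK // ltnS.
  apply: (@leq_trans (\sum_(j < k) (tnth q j * d + (r j).+1))).
    by rewrite (bigD1 i) //= leq_addr.
  rewrite sumE nE leq_add2r leq_mul2r (leq_trans qM) ?orbT //.
move: phi phiE => phi phiE.
rewrite -(card_in_imset (f := phi)); last first.
  move=> q1 q2; rewrite !inE => h1 h2 e; apply: eq_from_tnth => i.
  have := congr1 (fun y : {ffun 'I_k -> 'I_n.+1} => val (y i)) e.
  rewrite /= !phiE // => /eqP; rewrite eqn_add2r eqn_pmul2r // => /eqP.
  exact: val_inj.
congr #|pred_of_set _|; apply/setP => y; rewrite inE; apply/andP/imsetP.
  case=> yS yr; have {}yr := yE y yS yr.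
  move: yS; rewrite inE => /and4P[_ + _ _].
  under eq_bigr => i _ do rewrite yr.
  rewrite sumE.
  have -> m : (m * d + s < n) = (m * d + s < M.+1 * d + s) by rewrite -nE.
  rewrite ltn_add2r ltn_mul2r d0 /= ltnS => qM.
  have qiM i : (y i).-1 %/ d < M.+1.
    by rewrite ltnS (leq_trans _ qM) // (bigD1 i) //= leq_addr.
  exists [tuple Ordinal (qiM i) | i < k].
    rewrite inE qsum; under eq_bigr => i _ do rewrite tnth_mktuple.
    exact: qM.
  apply/ffunP => i; apply: val_inj; rewrite /= phiE.
    by rewrite tnth_mktuple /= -yr.
  by rewrite qsum; under eq_bigr => j _ do rewrite tnth_mktuple.
case=> q; rewrite inE => qM ->; split; last first.
  apply/eqP/ffunP => i; apply: val_inj; rewrite ffunE /= phiE //.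
  by rewrite addnS /= modnMDl modn_small.
have sE : \sum_i phi q i = (\sum_i tnth q i) * d + s.
  by rewrite -sumE; apply: eq_bigr => i _; rewrite phiE.
rewrite inE sE; apply/and4P; split.
- by apply/forallP => i; rewrite phiE // addnS.
- by rewrite [ltnRHS]nE ltn_add2r ltn_mul2r d0 /= ltnS -qsum.
- by rewrite [X in _ %| X - _]nE subnDr -mulnBl dvdn_mull.
- rewrite /dvdn (@eq_modn_prod _ _ (fun i => (r i).+1)) // => i.
  by rewrite phiE // modnMDl.
Qed.

(** Split the solutions by the residues of the y_i. These residues sum to n modulo d because x is a
    multiple of d. *)
Lemma card_divisible_sols (k n d : nat) : 0 < k -> 0 < d ->
  #|divisible_sols k n d| = \sum_(r in residues k d n)
     'C(((n - \sum_(i < k) (r i).+1) %/ d + k).-1, k).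
Proof.
move=> k0 d0.
rewrite -sum1_card (partition_big
  (fun y : {ffun 'I_k -> 'I_n.+1} =>
     [ffun i => Ordinal (ltn_pmod (y i).-1 d0)]) (mem (residues k d n))) /=.
  apply: eq_bigr => r rR; rewrite -(card_fiber d0 k0 rR) -sum1_card.
  by apply: eq_bigl => y; rewrite [in RHS]inE.
move=> y; rewrite !inE => /and4P[/forallP y0 sn dn dp].
have yE i : y i = ([ffun i => Ordinal (ltn_pmod (y i).-1 d0)] i).+1 %[mod d].
  rewrite ffunE /= -[in LHS](prednK (y0 i)); apply: eqn_modS.
  by rewrite modn_mod.
rewrite /dvdn -(eq_modn_prod yE) -(eq_modn_sum yE) -/(dvdn d _) dp.
by rewrite /= eq_sym eqn_mod_dvd ?(ltnW sn).
Qed.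

(** * Multiplicativity of the number of residue vectors *)

Lemma residues1 (k n : nat) : #|residues k 1 n| = 1.
Proof.
have -> : residues k 1 n = finset.setT.
  by apply/setP => r; rewrite !inE dvd1n !modn1 eqxx.
by rewrite cardsT card_ffun card_ord exp1n.
Qed.

(** Chinese remainder theorem in each coordinate: reduction modulo d and e is injective, and both
    defining conditions split along d and e. *)
Lemma residues_mul (k n d e : nat) : 0 < d -> 0 < e -> coprime d e ->
  #|residues k (d * e) n| = (#|residues k d n| * #|residues k e n|)%N.
Proof.
move=> d0 e0 de; have de0 : 0 < d * e by rewrite muln_gt0 d0.
rewrite -cardsX.
pose phi (r : {ffun 'I_k -> 'I_(d * e)}) :
    {ffun 'I_k -> 'I_d} * {ffun 'I_k -> 'I_e} :=
  ([ffun i => Ordinal (ltn_pmod (r i) d0)],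
   [ffun i => Ordinal (ltn_pmod (r i) e0)]).
have phi_inj : injective phi.
  move=> r s [/ffunP e1 /ffunP e2]; apply/ffunP => i; apply: val_inj.
  move: (congr1 val (e1 i)) (congr1 val (e2 i)); rewrite !ffunE /= => h1 h2.
  have /eqP : r i == s i %[mod d * e]
    by rewrite chinese_remainder // h1 h2 !eqxx.
  by rewrite !modn_small.
have phiE r : (phi r \in finset.setX (residues k d n) (residues k e n))
    = (r \in residues k (d * e) n).
  rewrite finset.in_setX !inE Gauss_dvd // chinese_remainder //.
  have h1 i : ((phi r).1 i).+1 = (r i).+1 %[mod d].
    by apply: eqn_modS; rewrite ffunE /= modn_mod.
  have h2 i : ((phi r).2 i).+1 = (r i).+1 %[mod e].
    by apply: eqn_modS; rewrite ffunE /= modn_mod.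
  rewrite /dvdn (eq_modn_prod h1) (eq_modn_prod h2) (eq_modn_sum h1).
  by rewrite (eq_modn_sum h2) andbACA.
rewrite -(card_imset _ phi_inj); congr #|pred_of_set _|; apply/setP => rs.
apply/imsetP/idP => [[r rR ->]|]; first by rewrite phiE.
pose r := [ffun i => Ordinal (ltn_pmod (chinese d e (rs.1 i) (rs.2 i)) de0)].
suff -> : rs = phi r by rewrite phiE; exists r.
case: rs @r => a b /=; rewrite /phi; congr pair;
  apply/ffunP => i; apply: val_inj; rewrite !ffunE /=.
  by rewrite modn_dvdm ?dvdn_mulr // chinese_modl // modn_small.
by rewrite modn_dvdm ?dvdn_mull // chinese_modr // modn_small.
Qed.

Lemma coprime_prime_prod (p : nat) (s : seq nat) :
  prime p -> all prime s -> p \notin s -> coprime p (\prod_(q <- s) q).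
Proof.
move=> pp sp ps; rewrite big_seq.
elim/big_rec: _ => [|q x qs cx]; first exact: coprimen1.
rewrite coprimeMr cx andbT prime_coprime // dvdn_prime2 ?(allP sp q qs) //.
by apply: contraNneq ps => ->.
Qed.

Lemma residues_prod (k n : nat) (s : seq nat) :
  uniq s -> all prime s ->
  #|residues k (\prod_(p <- s) p) n| = (\prod_(p <- s) #|residues k p n|)%N.
Proof.
elim: s => [|p s IHs] /=; first by rewrite !big_nil residues1.
move=> /andP[ps us] /andP[pp sp]; rewrite !big_cons.
have sp0 : 0 < \prod_(q <- s) q.
  by rewrite big_seq; apply: prodn_cond_gt0 => q /(allP sp)/prime_gt0.
by rewrite residues_mul ?(prime_gt0 pp) ?IHs ?coprime_prime_prod.
Qed.

(** * Residue vectors modulo a prime *)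

Definition ffun_cons (T : finType) (k : nat) (bg : T * {ffun 'I_k -> T}) :
    {ffun 'I_k.+1 -> T} :=
  [ffun i => if unlift ord0 i is Some j then bg.2 j else bg.1].

Lemma ffun_cons_bij (T : finType) (k : nat) : bijective (@ffun_cons T k).
Proof.
exists (fun r : {ffun 'I_k.+1 -> T} => (r ord0, [ffun j => r (lift ord0 j)])).
  case=> b g; rewrite /ffun_cons ffunE /= unlift_none; congr pair.
  by apply/ffunP => j; rewrite !ffunE liftK.
move=> r; apply/ffunP => i; rewrite ffunE /=.
by case: unliftP => [j|] ->; rewrite ?ffunE.
Qed.

Lemma sum_ffun_recl (T : finType) (k : nat) (F : {ffun 'I_k.+1 -> T} -> nat) :
  \sum_r F r = \sum_b \sum_(g : {ffun 'I_k -> T}) F (ffun_cons (b, g)).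
Proof.
rewrite (reindex (@ffun_cons T k)); last exact/onW_bij/ffun_cons_bij.
by rewrite pair_big; apply: eq_bigr => -[].
Qed.

Lemma big_ffun_cons (T : finType) (k : nat) (R : Type) (idx : R)
  (op : Monoid.law idx) (h : T -> R) (b : T) (g : {ffun 'I_k -> T}) :
  \big[op/idx]_i h (ffun_cons (b, g) i) = op (h b) (\big[op/idx]_i h (g i)).
Proof.
rewrite big_ord_recl ffunE unlift_none /=; congr (op _ _).
by apply: eq_bigr => i _; rewrite ffunE liftK.
Qed.

(** The map b to b + 1 + s modulo p permutes the residues, so it takes the value a once. *)
Lemma sum_shift_eqmod (p s a : nat) : 0 < p ->
  \sum_(b < p) (b.+1 + s == a %[mod p]) = 1.
Proof.
move=> p0; pose h (b : 'I_p) : 'I_p := Ordinal (ltn_pmod (b.+1 + s) p0).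
have h_inj : injective h.
  move=> b c /(congr1 val)/eqP /=; rewrite !addSnnS eqn_modDr.
  by rewrite !modn_small // => /eqP/val_inj.
pose c : 'I_p := Ordinal (ltn_pmod a p0).
transitivity (\sum_(b < p) (h b == c)); first by [].
have <- : \sum_(b < p) (b == c) = \sum_(b < p) (h b == c).
  by rewrite [LHS](reindex_inj h_inj).
rewrite (bigD1 c) //= eqxx big1 // => i.
by move=> /negbTE ->.
Qed.

Lemma sum_dvdS (p : nat) (P : pred 'I_p) : 0 < p ->
  \sum_(b < p) ((p %| b.+1) && P b) = \sum_(b < p | b.+1 == p) P b.
Proof.
move=> p0; rewrite [RHS]big_mkcond; apply: eq_bigr => b _.
have -> : (p %| b.+1) = (b.+1 == p).
  apply/idP/eqP => [/dvdn_leq h|->//].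
  by apply/eqP; rewrite eqn_leq ltn_ord h.
by case: eqP.
Qed.

Definition unit_count (p k : nat) : nat :=
  \sum_(r : {ffun 'I_k -> 'I_p}) ~~ (p %| \prod_i (r i).+1).

(** The complement of [residues] among the vectors with the right sum. A product of units is tested
    coordinate by coordinate, which allows recursion on k. *)
Definition unit_sols (p k a : nat) : nat :=
  \sum_(r : {ffun 'I_k -> 'I_p})
    (~~ (p %| \prod_i (r i).+1) && (\sum_i (r i).+1 == a %[mod p])).

Lemma sum_dvdS_eqmod (p : nat) (pp : prime p) (s a : nat) :
  \sum_(b < p) ((p %| b.+1) && (b.+1 + s == a %[mod p])) = (s == a %[mod p]).
Proof.
have p0 := prime_gt0 pp; rewrite sum_dvdS //.
have pb : p.-1 < p by rewrite prednK.
rewrite (big_pred1 (Ordinal pb)) /= => [|b].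
  by rewrite prednK // modnDl.
apply/eqP/eqP => [e|->]; last by rewrite /= prednK.
by apply: val_inj; apply: (congr1 predn e).
Qed.

Lemma sum_ndvdS_eqmod (p : nat) (pp : prime p) (s a : nat) :
  \sum_(b < p) (~~ (p %| b.+1) && (b.+1 + s == a %[mod p]))
    + (s == a %[mod p]) = 1.
Proof.
rewrite -(sum_dvdS_eqmod pp) -big_split /=.
rewrite -[RHS](sum_shift_eqmod s a (prime_gt0 pp)).
by apply: eq_bigr => b _; case: (p %| _); case: (_ == _).
Qed.

Lemma sum_ndvdS (p : nat) (pp : prime p) : \sum_(b < p) ~~ (p %| b.+1) = p.-1.
Proof.
have : \sum_(b < p) ~~ (p %| b.+1)
    + \sum_(b < p) ((p %| b.+1) && (b.+1 + 0 == 0 %[mod p])) = p.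
  rewrite -big_split /= -[RHS]card_ord -sum1_card; apply: eq_bigr => b _.
  by rewrite addn0 mod0n -/(p %| _); case: (p %| _).
by rewrite sum_dvdS_eqmod // eqxx; have := prime_gt0 pp; lia.
Qed.

Lemma prod_cons_dvd (p : nat) (pp : prime p) (k : nat)
    (b : 'I_p) (g : {ffun 'I_k -> 'I_p}) :
  p %| \prod_i (ffun_cons (b, g) i).+1
  = (p %| b.+1) || (p %| \prod_i (g i).+1).
Proof.
by rewrite (big_ffun_cons muln (fun c : 'I_p => c.+1)) Euclid_dvdM.
Qed.

Lemma unit_countE (p : nat) (pp : prime p) (k : nat) :
  unit_count p k = p.-1 ^ k.
Proof.
rewrite /unit_count; elim: k => [|k IHk].
  rewrite (eq_bigr (fun=> 1)) => [|r _].
    by rewrite sum_nat_const card_ffun !card_ord expn0.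
  by rewrite big_ord0 dvdn1 (gtn_eqF (prime_gt1 pp)).
rewrite sum_ffun_recl expnS -IHk -(sum_ndvdS pp) big_distrl /=.
apply: eq_bigr => b _; rewrite big_distrr /=; apply: eq_bigr => g _.
by rewrite prod_cons_dvd //; case: (p %| _); case: (p %| _).
Qed.

Lemma unit_sols0 (p : nat) (pp : prime p) (a : nat) :
  unit_sols p 0 a = (p %| a).
Proof.
rewrite /unit_sols (eq_bigr (fun=> nat_of_bool (p %| a))) => [|r _].
  by rewrite sum_nat_const card_ffun !card_ord expn0 mul1n.
by rewrite !big_ord0 dvdn1 mod0n (gtn_eqF (prime_gt1 pp)) /= eq_sym.
Qed.

(** Fix the last k coordinates, all units. The sum determines the first one, which is a unit unless
    the others already sum to a; so each such vector is counted in exactly one of the two terms. *)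
Lemma unit_solsS (p : nat) (pp : prime p) (k a : nat) :
  unit_sols p k.+1 a + unit_sols p k a = p.-1 ^ k.
Proof.
rewrite /unit_sols sum_ffun_recl exchange_big -big_split -(unit_countE pp).
apply: eq_bigr => g _ /=.
under eq_bigr => b _ do rewrite (prod_cons_dvd pp)
  (big_ffun_cons addn (fun c : 'I_p => c.+1)) negb_or.
case: (p %| \prod_i (g i).+1) => /=.
  by under eq_bigr => b _ do rewrite andbF; rewrite big1.
under eq_bigr => b _ do rewrite andbT.
exact: sum_ndvdS_eqmod.
Qed.

Lemma all_sols (p : nat) (pp : prime p) (k a : nat) :
  \sum_(r : {ffun 'I_k.+1 -> 'I_p}) (\sum_i (r i).+1 == a %[mod p]) = p ^ k.
Proof.
rewrite sum_ffun_recl exchange_big /= (eq_bigr (fun=> 1)) => [|g _].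
  by rewrite sum_nat_const card_ffun !card_ord muln1.
under eq_bigr => b _ do rewrite (big_ffun_cons addn (fun c : 'I_p => c.+1)).
exact: sum_shift_eqmod (prime_gt0 pp).
Qed.

Lemma residues_unit_sols (p : nat) (pp : prime p) (k n : nat) :
  #|residues k.+1 p n| + unit_sols p k.+1 n = p ^ k.
Proof.
rewrite -sum1_card big_mkcond -big_split /= -(all_sols pp k n).
apply: eq_bigr => r _; rewrite inE.
by case: (p %| _); case: (_ == _).
Qed.

(** * Sets of primes and the sieve identity *)

Lemma prime_prod_dvd (s : seq nat) (m : nat) :
  uniq s -> all prime s -> (\prod_(p <- s) p %| m) = all (fun p => p %| m) s.
Proof.
elim: s => [|p s IHs] /=; first by rewrite big_nil dvd1n.
move=> /andP[ps us] /andP[pp sp].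
by rewrite big_cons Gauss_dvd ?coprime_prime_prod // IHs.
Qed.

Lemma prod_set_seq (N : nat) (J : {set 'I_N}) :
  \prod_(p in J) p = \prod_(p <- map val (enum J)) p.
Proof. by rewrite big_map big_enum. Qed.

Lemma all_enum (N : nat) (J : {set 'I_N}) (P : pred nat) :
  all P (map val (enum J)) = [forall p in J, P (val p)].
Proof.
rewrite all_map; apply/allP/forall_inP => h p pJ; apply: h; rewrite ?mem_enum //.
by rewrite -mem_enum.
Qed.

Lemma uniq_val_enum (N : nat) (J : {set 'I_N}) : uniq (map val (enum J)).
Proof. by rewrite map_inj_uniq ?enum_uniq //; exact: val_inj. Qed.

Lemma prime_set_dvd (N : nat) (J : {set 'I_N}) (m : nat) :
  [forall p in J, prime p] ->
  (\prod_(p in J) p %| m) = [forall p in J, p %| m].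
Proof.
move=> Jp; rewrite prod_set_seq prime_prod_dvd ?uniq_val_enum ?all_enum //.
Qed.

Lemma residues_prime_set (k n N : nat) (J : {set 'I_N}) :
  [forall p in J, prime p] ->
  #|residues k (\prod_(p in J) p) n| = \prod_(p in J) #|residues k p n|.
Proof.
move=> Jp; rewrite prod_set_seq residues_prod ?uniq_val_enum ?all_enum //.
by rewrite big_map big_enum.
Qed.

Lemma prime_set_prod_gt0 (N : nat) (J : {set 'I_N}) :
  [forall p in J, prime p] -> 0 < \prod_(p in J) p.
Proof.
by move=> /forall_inP Jp; apply: prodn_cond_gt0 => p /Jp/prime_gt0.
Qed.

(** J is recovered as the set of primes below N that divide its product. *)
Lemma prime_set_prod_inj (N : nat) :
  {in [pred J : {set 'I_N} | [forall p in J, prime p]] &,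
    injective (fun J : {set 'I_N} => \prod_(p in J) p)}.
Proof.
have memJ (J : {set 'I_N}) (q : 'I_N) : [forall p in J, prime p] ->
    (q \in J) = prime q && (q %| \prod_(p in J) p).
  move=> Jp; apply/idP/andP => [qJ|[pq]].
    by rewrite (forall_inP Jp) // (bigD1 q) //= dvdn_mulr.
  rewrite Euclid_dvd_prod // big_orE => /existsP[p /andP[pJ]].
  by rewrite dvdn_prime2 ?(forall_inP Jp p pJ) // => /eqP/val_inj ->.
move=> J K; rewrite !inE => Jp Kp e; apply/setP => q.
by rewrite !memJ // e.
Qed.

(** The sum determines x from the y_i, so forgetting x is injective. *)
Lemma A_sols (k n : nat) :
  A k n = #|[set y : {ffun 'I_k -> 'I_n.+1} |
    [&& [forall i, 0 < y i], \sum_(i < k) y i < n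
      & coprime (n - \sum_(i < k) y i) (\prod_(i < k) y i)]]|.
Proof.
rewrite /A -(card_in_imset (f := snd)); last first.
  move=> [x1 y1] [x2 y2]; rewrite !inE /= => /and4P[_ _ /eqP e1 _].
  move=> /and4P[_ _ /eqP e2 _] e; rewrite -e in e2 *; congr pair.
  by apply/val_inj/eqP; rewrite /= -(eqn_add2r (\sum_i y1 i)) -e1 -e2.
congr #|pred_of_set _|; apply/setP => y; rewrite inE.
apply/imsetP/and3P => [[[x z]]|[y0 sn cop]].
  rewrite inE /= => /and4P[x0 z0 /eqP e cop ->]; split => //.
    by rewrite [ltnRHS]e -[ltnLHS]add0n ltn_add2r.
  by rewrite [X in coprime (X - _)]e addnK.
have h : n - \sum_i y i < n.+1 by rewrite ltnS leq_subr.
exists (Ordinal h, y) => //; rewrite inE /= y0 cop subn_gt0 sn andbT /=.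
by rewrite subnK // ltnW.
Qed.

Lemma coprimeBl (m b : nat) : b <= m -> coprime (m - b) b = coprime m b.
Proof.
by move=> h; rewrite -{2}(subnK h) coprime_sym [RHS]coprime_sym /coprime gcdnDr.
Qed.

(** For x = n - b, gcd(x, b) = gcd(n, b). *)
Lemma A1_totient (n : nat) : 1 < n -> A 1 n = totient n.
Proof.
move=> n1; rewrite A_sols totient_count_coprime.
rewrite -sum1_card (reindex (fun b : 'I_n.+1 => [ffun=> b])) /=; last first.
  apply: onW_bij; exists (fun y : {ffun 'I_1 -> 'I_n.+1} => y ord0).
    by move=> b; rewrite ffunE.
  by move=> y; apply/ffunP => i; rewrite ffunE (ord1 i).
rewrite big_mkcond big_ord_recr /= big_mkord.
rewrite !inE !big_ord_recl !big_ord0 !ffunE /= addn0 muln1 ltnn andbF addn0.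
apply: eq_bigr => b _.
rewrite inE !big_ord_recl !big_ord0 !ffunE /= addn0 muln1 ltn_ord /=.
have -> :
    [forall i, 0 < ([ffun=> widen_ord (leqnSn n) b] : {ffun 'I_1 -> 'I_n.+1}) i] = (0 < b).
  by apply/forallP/idP => [/(_ ord0)|b0 i]; rewrite ffunE.
rewrite coprimeBl ?(ltnW (ltn_ord b)) //.
(* b = 0 is not a solution, and the totient does not count it either since gcd(n, 0) = n > 1. *)
case: posnP => [->|b0]; last by case: coprime.
by rewrite /coprime gcdn0 (gtn_eqF n1).
Qed.

(** * Closed form of the count modulo a prime, and the sieve over sets of primes *)

Local Open Scope ring_scope.

(** Solves the recurrence [unit_solsS]. The factor p avoids division, so the formula serves over the
    integers as well as the reals. *)
Lemma unit_sols_eq (R : comNzRingType) (p : nat) (pp : prime p) (k a : nat) :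
  p%:R * (unit_sols p k a)%:R
  = (p%:R - 1) ^+ k + (-1) ^+ k * (p%:R * (p %| a)%N%:R - 1) :> R.
Proof.
elim: k => [|k IHk]; first by rewrite unit_sols0 // !expr0; ring.
have /(congr1 (fun m => m%:R : R)) := unit_solsS pp k a.
rewrite natrD natrX -subn1 natrB ?prime_gt0 // => /(canRL (addrK _)) ->.
by rewrite mulrBr IHk !exprS; ring.
Qed.

Lemma residues_prime (R : comNzRingType) (p : nat) (pp : prime p) (k n : nat) :
  (0 < k)%N ->
  p%:R * #|residues k p n|%:R
  = p%:R ^+ k - (p%:R - 1) ^+ k + (-1) ^+ k
    - (-1) ^+ k * (p%:R * (p %| n)%N%:R) :> R.
Proof.
case: k => // k _.
have /(congr1 (fun m => m%:R : R)) := residues_unit_sols pp k n.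
rewrite natrD natrX => /(canRL (addrK _)) ->.
by rewrite mulrBr unit_sols_eq // !exprS; ring.
Qed.

(** Heuristically: choose the vanishing coordinate, then k - 2 free ones, and the sum fixes the
    last. The proof instead bounds the closed form. *)
Lemma residues_prime_le (p : nat) (pp : prime p) (k n : nat) : (1 < k)%N ->
  (#|residues k p n| <= k * p ^ (k - 2))%N.
Proof.
move=> k1.
suff : p%:R * #|residues k p n|%:R <= p%:R * (k * p ^ (k - 2))%:R :> int.
  by rewrite -!natrM ler_nat leq_pmul2l ?prime_gt0.
rewrite residues_prime ?(ltnW k1) //.
have p2 : 2 <= p%:R :> int by rewrite (ler_nat _ 2) prime_gt1.
case: k k1 => [|[|k]] // _; rewrite subn2 /= natrM natrX.
move: (p%:R : int) p2 => x x2.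
have xk j : 1 <= x ^+ j by apply: exprn_ege1; lia.
(* The saved term x ^+ k is what absorbs the sign term below. *)
have diff : x ^+ k.+2 - (x - 1) ^+ k.+2 <= k.+2%:R * x ^+ k.+1 - x ^+ k.
  elim: k => [|k IHk]; first by rewrite !exprS !expr0; lia.
  rewrite exprS [(x - 1) ^+ k.+3]exprS.
  have -> : k.+3%:R = k.+2%:R + 1 :> int by rewrite -natr1.
  have := ler_wpM2l (_ : 0 <= x - 1) IHk.
  rewrite ![x ^+ k.+2]exprS ![x ^+ k.+1]exprS.
  set y := (x - 1) ^+ k.+2; set z := x ^+ k; move=> h.
  have {}h := h ltac:(lia).
  have hz : z <= k.+2%:R * (x * z).
    rewrite mulrA ler_peMl //; first by have := xk k; rewrite -/z; lia.
    by rewrite (@le_trans _ _ (1 * x)) ?ler_wpM2r //; lia.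
  suff -> : x * (x * (x * z)) - (x - 1) * y
    = (x - 1) * (x * (x * z) - y) + x * (x * z) by lia.
  ring.
(* For even exponent the left side is at most 1; for odd exponent it is at most x - 1, and then the
   exponent on the right is at least 1. *)
have sgn : (-1) ^+ k.+2 - (-1) ^+ k.+2 * (x * (p %| n)%N%:R) <= x ^+ k.
  rewrite -signr_odd /= negbK; case: k {diff} => [|k] /=.
    by rewrite !expr0; case: (p %| n)%N; lia.
  have xk1 : x <= x ^+ k.+1 by rewrite exprS ler_peMr //; lia.
  by case: odd; rewrite ?expr0 ?expr1; case: (p %| n)%N; lia.
rewrite [x * (_ * _)]mulrCA -exprS; lia.
Qed.

(** Expansion of the product. A set J of primes stands for the squarefree d that is its product, and
    (-1) ^+ #|J| for mu(d). *)
Lemma sum_prime_sets (R : comNzRingType) (N : nat) (g : nat -> R) :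
  \sum_(J : {set 'I_N} | [forall p in J, prime p]) \prod_(p in J) g p
  = \prod_(p < N | prime p) (1 + g p).
Proof.
rewrite [RHS]big_mkcond /=.
(* Weight 0 on non-primes lets the expansion run over all subsets of 'I_N. *)
rewrite (eq_bigr (fun p : 'I_N => (if prime p then g p else 0) + 1)) => [|p _];
  last by case: prime; rewrite ?add0r // addrC.
rewrite bigA_distr big_mkcond; apply: eq_bigr => J _.
rewrite -big_mkcond /=; case: ifPn => [/forall_inP Jp|].
  by apply: eq_bigr => p pJ; rewrite Jp.
rewrite negb_forall_in => /exists_inP[p pJ /negbTE nP].
by rewrite (bigD1 p) //= nP mul0r.
Qed.

Lemma sum_signed_prime_sets (R : comNzRingType) (N : nat) (P : pred nat) :
  \sum_(J : {set 'I_N} | [forall p in J, prime p])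
     (-1) ^+ #|J| * [forall p in J, P (val p)]%:R
  = \prod_(p < N | prime p) (1 - (P p)%:R) :> R.
Proof.
rewrite -(sum_prime_sets N (fun p => - (P p)%:R)).
apply: eq_bigr => J _; rewrite prodrN; congr (_ * _).
have [/forall_inP JP|] := boolP [forall p in J, P (val p)].
  by rewrite big1 // => p pJ; rewrite (JP p pJ).
rewrite negb_forall_in => /exists_inP[p pJ /negbTE nP].
by rewrite (bigD1 p) //= nP mul0r.
Qed.

(** A common prime factor divides a, so it is below N and makes a factor vanish. *)
Lemma coprime_indicator (R : comNzRingType) (N a b : nat) :
  (0 < a < N)%N ->
  \prod_(p < N | prime p) (1 - ((p %| a)%N && (p %| b)%N)%:R)
  = (coprime a b)%:R :> R.
Proof.
move=> /andP[a0 aN]; have [cop|] := boolP (coprime a b).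
  rewrite big1 // => p pp; rewrite -dvdn_gcd (eqP cop) dvdn1.
  by rewrite (gtn_eqF (prime_gt1 pp)) subr0.
move=> ncop; have g1 : (1 < gcdn a b)%N.
  by rewrite ltn_neqAle eq_sym ncop gcdn_gt0 a0.
have pN : (pdiv (gcdn a b) < N)%N.
  rewrite (leq_ltn_trans _ aN) // dvdn_leq //.
  by rewrite (dvdn_trans (pdiv_dvd _)) ?dvdn_gcdl.
rewrite (bigD1 (Ordinal pN)) /= ?pdiv_prime //.
by rewrite -dvdn_gcd pdiv_dvd subrr mul0r.
Qed.

(** Legendre's sieve: expand the coprimality indicator of each y over sets of primes, then exchange
    the sums. *)
Lemma sieve (R : comNzRingType) (k n N : nat) : (n < N)%N ->
  (A k n)%:R = \sum_(J : {set 'I_N} | [forall p in J, prime p])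
    (-1) ^+ #|J| * #|divisible_sols k n (\prod_(p in J) p)%N|%:R :> R.
Proof.
move=> nN; rewrite A_sols -sum1_card natr_sum.
have -> : \sum_(J : {set 'I_N} | [forall p in J, prime p])
    (-1) ^+ #|J| * #|divisible_sols k n (\prod_(p in J) p)%N|%:R =
  \sum_(y : {ffun 'I_k -> 'I_n.+1} |
     [forall i, (0 < y i)%N] && (\sum_i y i < n)%N)
   \prod_(p < N | prime p)
     (1 - ((p %| n - \sum_i y i)%N && (p %| \prod_i y i)%N)%:R) :> R.
  under [RHS]eq_bigr => y _ do rewrite -(sum_signed_prime_sets _ _
    (fun p => (p %| n - \sum_i y i)%N && (p %| \prod_i y i)%N)).
  rewrite exchange_big /=; apply: eq_bigr => J Jp.
  rewrite -big_distrr /=; congr (_ * _).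
  rewrite -sum1_card natr_sum big_mkcond [RHS]big_mkcond /=.
  apply: eq_bigr => y _; rewrite inE !prime_set_dvd //.
  have -> : [forall p in J, (p %| n - \sum_i y i)%N && (p %| \prod_i y i)%N]
     = [forall p in J, (p %| n - \sum_i y i)%N]
       && [forall p in J, (p %| \prod_i y i)%N].
    apply/forall_inP/andP => [h|[/forall_inP h1 /forall_inP h2] p pJ].
      by split; apply/forall_inP => p /h/andP[].
    by rewrite h1 // h2.
  by case: (X in X && _) => //=; case: (_ < _)%N => //=; case: (_ && _).
rewrite big_mkcond [RHS]big_mkcond /=; apply: eq_bigr => y _; rewrite inE.
rewrite andbA; case: (boolP ([forall i, _] && (_ < n)%N)) => //= /andP[y0 sn].
rewrite coprime_indicator ?subn_gt0 ?sn ?(leq_ltn_trans (leq_subr _ _) nN) //.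
by case: coprime.
Qed.

(** * Approximation of the binomial coefficients *)

(** In the binomial expansion every term containing c has a power of t of exponent at most j, hence
    at most t ^+ j as t >= 1; at t = 1 there is equality. *)
Lemma exprD_le (R : realFieldType) (j : nat) (t c : R) : 1 <= t -> 0 <= c ->
  (t + c) ^+ j.+1 <= t ^+ j.+1 + ((1 + c) ^+ j.+1 - 1) * t ^+ j.
Proof.
move=> t1 c0; elim: j => [|j IHj]; first by rewrite !expr1 expr0; lra.
have tj : 0 <= t ^+ j by rewrite exprn_ge0 //; lra.
rewrite exprS (le_trans (ler_wpM2l _ IHj)) //; first lra.
rewrite exprS [(1 + c) ^+ j.+2]exprS [t ^+ j.+2]exprS.
have e0 : 0 <= (1 + c) ^+ j.+1 - 1 by rewrite subr_ge0 exprn_ege1 //; lra.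
rewrite ![t ^+ j.+1]exprS; move: e0 tj.
move: ((1 + c) ^+ j.+1) (t ^+ j) => E x E0 x0.
have : 0 <= c * (E - 1) * (t - 1) * x by rewrite !mulr_ge0 //; lra.
by lra.
Qed.

(** Mean value bound: the slope of the power on [t - c, t] is at most (j + 1) t ^+ j. *)
Lemma exprB_ge (R : realFieldType) (j : nat) (t c : R) : 0 <= c -> c <= t ->
  t ^+ j.+1 - (t - c) ^+ j.+1 <= j.+1%:R * c * t ^+ j.
Proof.
move=> c0 ct; elim: j => [|j IHj]; first by rewrite !expr1 expr0; lra.
have tj : 0 <= t ^+ j.+1 by rewrite exprn_ge0 //; lra.
have := ler_wpM2l (_ : 0 <= t - c) IHj; rewrite subr_ge0 => /(_ ct) h.
rewrite exprS [(t - c) ^+ _]exprS -[j.+2%:R]natr1.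
rewrite [t ^+ j.+1]exprS in h tj *.
have : 0 <= c * c * j.+1%:R * t ^+ j.
  by rewrite !mulr_ge0 // exprn_ge0 //; lra.
lra.
Qed.

Lemma leq_exp_ffact (u k j : nat) : (j <= k.+1)%N -> ((u - k) ^ j <= u ^_ j)%N.
Proof.
elim: j => // j IHj jk.
by rewrite ffactnSr expnSr leq_mul ?IHj ?(ltnW jk) // leq_sub2l.
Qed.

(** The falling factorial lies between (u - k + 1) ^ k and u ^ k, hence for t > k between (t - k) ^
    k and (t + k - 1) ^ k. The upper side yields the constant k ^ k - 1, the lower one k ^ 2 <= k ^
    k. *)
Lemma ffact_approx (R : realFieldType) (k u : nat) (t : R) :
  (1 < k)%N -> 1 <= t -> t <= u.+1%:R -> u.+1%:R <= t + k%:R ->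
  `| (u ^_ k)%:R - t ^+ k | <= k%:R ^+ k * t ^+ k.-1.
Proof.
case: k => [|k] // k1 t1 tu ut; rewrite /=.
have tk : 0 <= t ^+ k by rewrite exprn_ge0 //; lra.
have kk : k.+1%:R <= k.+1%:R ^+ k.+1 :> R.
  by rewrite exprS ler_peMr // exprn_ege1 // ler1n.
rewrite ler_norml; apply/andP; split; last first.
  have h1 : (u ^_ k.+1)%:R <= u%:R ^+ k.+1 :> R.
    rewrite -natrX ler_nat; elim: (k.+1) => [|j IHj]; first by rewrite ffactn0.
    by rewrite ffactnSr expnSr leq_mul // leq_subr.
  have h2 : u%:R ^+ k.+1 <= (t + k%:R) ^+ k.+1 :> R.
    rewrite lerXn2r ?nnegrE //.
      by rewrite addr_ge0 //; lra.
    by move: ut; rewrite -!natr1; lra.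
  have := exprD_le k t1 (ler0n R k); rewrite [1 + k%:R]addrC natr1.
  lra.
(* For small t the power of t is itself within the error. *)
have [tk1|kt] := lerP t k.+1%:R.
  have : t ^+ k.+1 <= k.+1%:R ^+ k.+1 * t ^+ k.
    by rewrite exprS ler_wpM2r // (le_trans tk1).
  have := ler0n R (u ^_ k.+1); lra.
have h1 : (t - k.+1%:R) ^+ k.+1 <= (u ^_ k.+1)%:R :> R.
  have ku : (k.+1 <= u)%N.
    by rewrite -ltnS -(ltr_nat R) (lt_le_trans kt).
  have h : ((u - k) ^ k.+1)%:R <= (u ^_ k.+1)%:R :> R.
    by rewrite ler_nat leq_exp_ffact.
  apply: le_trans h; rewrite natrX lerXn2r ?nnegrE // ?subr_ge0 ?(ltW kt) //.
  by rewrite natrB ?(ltnW ku) //; move: tu; rewrite -!natr1; lra.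
have := exprB_ge k (ler0n R k.+1) (ltW kt).
have : k.+1%:R * k.+1%:R * t ^+ k <= k.+1%:R ^+ k.+1 * t ^+ k.
  rewrite ler_wpM2r // -expr2 -!natrX ler_nat leq_exp2l //.
move: h1; move: (_ ^+ _) (_ ^+ k.+1) (_ * t ^+ k) (_ * t ^+ k).
by move=> a b c d; lra.
Qed.

(** * Rankin's trick *)

(** Discrete form of bounding s x^(-1-s) below by its value at m + 1 on [m, m + 1]. *)
Lemma powR_telescope (R : realType) (s : R) (m : nat) : 0 < s -> (0 < m)%N ->
  s * (m.+1%:R `^ (- (1 + s))) <= m%:R `^ (- s) - m.+1%:R `^ (- s).
Proof.
move=> s0 m0; have m0R : 0 < m%:R :> R by rewrite ltr0n.
set M : R := m.+1%:R; have M0 : 0 < M by rewrite ltr0n.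
(* exp(-1/M) >= 1 - 1/M = m/M gives M/m >= exp(1/M); raise to the power s and use exp(s/M) >= 1 +
   s/M. *)
have h : 1 + s / M <= (M / m%:R) `^ s.
  apply: (le_trans (expR_ge1Dx _)); rewrite [s / M]mulrC expRM.
  apply: ge0_ler_powR;
    rewrite ?nnegrE ?expR_ge0 ?divr_ge0 ?(ltW s0) ?(ltW m0R) ?(ltW M0) //.
  rewrite -[leLHS]invrK -expRN -[leRHS]invrK invf_div.
  rewrite lef_pV2 ?posrE ?expR_gt0 ?divr_gt0 //.
  apply: le_trans (expR_ge1Dx _).
  by rewrite ler_pdivrMr // mulrDl mulNr mulVf ?gt_eqF // mul1r /M -natr1; lra.
rewrite opprD powRD ?(gt_eqF M0) ?implybT // powR_inv1 ?(ltW M0) //.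
have {h} : M `^ (- s) * (1 + s / M) <= M `^ (- s) * (M / m%:R) `^ s.
  by rewrite ler_wpM2l ?powR_ge0.
rewrite powRM ?invr_ge0 ?(ltW m0R) ?(ltW M0) // mulrA.
rewrite powRN mulVf ?mul1r; last first.
  by rewrite gt_eqF ?powR_gt0.
rewrite -[m%:R^-1]powR_inv1 ?(ltW m0R) // -powRrM mulN1r powRN.
by move: _^-1 _^-1 M^-1 => a b c; lra.
Qed.

Lemma sum_powR_le (R : realType) (s : R) (M : nat) : 0 < s ->
  \sum_(1 <= m < M.+1) m%:R `^ (- (1 + s)) <= 1 + s^-1.
Proof.
move=> s0; case: M => [|M].
  by rewrite big_geq // addr_ge0 // invr_ge0 ltW.
suff : \sum_(1 <= m < M.+2) m%:R `^ (- (1 + s))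
     <= 1 + s^-1 * (1 - M.+1%:R `^ (- s)).
  move/le_trans; apply.
  rewrite lerD2l ler_piMr ?invr_ge0 ?(ltW s0) ?gerBl ?powR_ge0 //.
elim: M => [|M IHM]; first by rewrite big_nat1 !powR1 subrr mulr0 addr0.
rewrite big_nat_recr //= (le_trans (lerD IHM (lexx _))) //.
have := powR_telescope s0 (ltn0Sn M); rewrite mulrC -ler_pdivlMr // => h.
rewrite (le_trans (lerD (lexx _) h)) // mulrC; lra.
Qed.

(** With t = n/d: for d <= n the factor t^s is at least 1 and only weakens the bound of
    [ffact_approx]; for d > n it admits the main term t^k, all that is left. *)
Lemma card_divisible_sols_approx (R : realType) (k n d : nat) (s : R) :
  (1 < k)%N -> (0 < d)%N -> (0 < n)%N -> 0 <= s <= 1 ->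
  `| #|divisible_sols k n d|%:R
     - #|residues k d n|%:R * ((n%:R / d%:R) ^+ k / k`!%:R) |
  <= #|residues k d n|%:R * (k%:R ^+ k / k`!%:R
       * ((n%:R / d%:R) ^+ k.-1 * (n%:R / d%:R) `^ s)) :> R.
Proof.
move=> k1 d0 n0 /andP[s0 s1]; set t : R := n%:R / d%:R.
have k0 : (0 < k)%N by exact: ltnW.
have d0R : 0 < d%:R :> R by rewrite ltr0n.
have t0 : 0 < t by rewrite /t divr_gt0 ?ltr0n.
have f0 : 0 < k`!%:R :> R by rewrite ltr0n fact_gt0.
rewrite card_divisible_sols // natr_sum.
rewrite -!sum1_card !natr_sum !mulr_suml -sumrB.
apply: le_trans (ler_norm_sum _ _ _) _; apply: ler_sum => r rR.
rewrite !mul1r mulrAC.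
rewrite -(ler_pM2r f0) divfK ?gt_eqF //.
rewrite -[X in _ * X <= _](gtr0_norm f0) -normrM mulrBl.
rewrite divfK ?gt_eqF // -natrM bin_ffact.
have [nd|dn] := ltnP n d.
  rewrite divn_small ?(leq_ltn_trans (leq_subr _ _) nd) //.
  rewrite ffact_small ?prednK // sub0r normrN ger0_norm ?exprn_ge0 ?(ltW t0) //.
  have t1 : t <= 1 by rewrite ler_pdivrMr // mul1r ler_nat ltnW.
  rewrite -{1}(prednK k0) exprSr [leRHS]mulrCA.
  rewrite ler_wpM2l ?exprn_ge0 ?(ltW t0) //.
  rewrite -[leLHS]mul1r ler_pM ?(ltW t0) ?exprn_ege1 ?ler1n //.
  by rewrite ger1_powR // t0.
have t1 : 1 <= t by rewrite ler_pdivlMr // mul1r ler_nat.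
have ts : 1 <= t `^ s by rewrite -(powRr0 t) ler_powR.
set sr := (\sum_(i < k) (r i).+1)%N.
have srle : (sr <= k * d)%N.
  rewrite -[X in (_ <= X * _)%N](card_ord k) -sum_nat_const.
  by apply: leq_sum => i _; exact: ltn_ord.
have uE : (((n - sr) %/ d + k).-1.+1)%N = ((n - sr) %/ d + k)%N.
  by rewrite prednK // addn_gt0 k0 orbT.
apply: le_trans (ffact_approx k1 t1 _ _) _; rewrite ?uE ?natrD ?lerD2r.
(* If the subtraction truncates, the quotient is 0, but then n <= sr <= k d still gives t <= k. *)
- have [ns|sn] := leqP n sr.
    rewrite (eqP ns) div0n add0r ler_pdivrMr //.
    by rewrite -natrM ler_nat (leq_trans ns).
  have dvd : (d %| n - sr)%N.
    move: rR; rewrite inE => /andP[_]; rewrite eq_sym.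
    by rewrite eqn_mod_dvd // ltnW.
  have qE : ((n - sr) %/ d)%:R = t - sr%:R / d%:R :> R.
    rewrite /t -mulrBl -natrB ?(ltnW sn) //; apply: (canRL (mulfK _)).
      by rewrite gt_eqF.
    by rewrite -natrM divnK.
  by rewrite qE -addrA lerDl addrC subr_ge0 ler_pdivrMr // -natrM ler_nat.
- rewrite /t ler_pdivlMr // -natrM ler_nat.
  by rewrite (leq_trans (leq_divM _ _)) ?leq_subr.
- by rewrite ler_wpM2l ?exprn_ge0 // ler_peMr ?exprn_ge0 // ltW.
Qed.

Lemma powR_prod (R : realType) (I : finType) (P : pred I) (F : I -> R) (s : R) :
  (forall i, P i -> 0 <= F i) ->
  (\prod_(i | P i) F i) `^ s = \prod_(i | P i) F i `^ s.
Proof.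
move=> F0; suff [] : 0 <= \prod_(i | P i) F i /\
  (\prod_(i | P i) F i) `^ s = \prod_(i | P i) F i `^ s by [].
elim/big_rec2: _ => [|i x y Pi [x0 <-]]; first by rewrite powR1.
by rewrite powRM ?mulr_ge0 ?F0.
Qed.

(** The expanded product is a sum over distinct squarefree integers, so it is at most a partial sum
    of zeta(1 + s). *)
Lemma euler_product_le (R : realType) (N : nat) (s : R) : 0 < s ->
  \prod_(p < N | prime p) (1 + p%:R `^ (- (1 + s))) <= 1 + s^-1.
Proof.
move=> s0; rewrite -(sum_prime_sets N (fun p => p%:R `^ (- (1 + s)))).
pose D (J : {set 'I_N}) := (\prod_(p in J) p)%N.
pose M := (\max_(J : {set 'I_N}) D J)%N.
have DM J : (D J < M.+1)%N by rewrite ltnS (leq_bigmax J).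
apply: (le_trans _ (sum_powR_le M s0)).
rewrite big_geq_mkord /=.
pose DO J := Ordinal (DM J).
have DO_inj :
    {in [pred J : {set 'I_N} | [forall p in J, prime p]] &, injective DO}.
  by move=> J K Jp Kp /(congr1 val); exact: (prime_set_prod_inj Jp Kp).
rewrite (eq_bigr (fun J => (DO J)%:R `^ (- (1 + s)))); last first.
  by move=> J _; rewrite natr_prod powR_prod.
rewrite -(big_imset (fun m : 'I_M.+1 => m%:R `^ (- (1 + s))) DO_inj) /=.
rewrite big_mkcond [leRHS]big_mkcond; apply: ler_sum => m _.
case: imsetP => [[J /= Jp ->]|_]; last by case: ifP; rewrite ?powR_ge0.
by rewrite prime_set_prod_gt0.
Qed.

Lemma bernoulli_le (R : realFieldType) (k : nat) (x : R) : 0 <= x ->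
  1 + k%:R * x <= (1 + x) ^+ k.
Proof.
move=> x0; elim: k => [|k IHk]; first by rewrite mul0r addr0 expr0.
rewrite exprS; apply: le_trans (ler_wpM2l _ IHk); last by rewrite addr_ge0.
have : 0 <= k%:R * x * x by rewrite !mulr_ge0.
by rewrite -natr1; lra.
Qed.

Lemma local_weight_le (R : realType) (k n p : nat) (s : R) :
  (1 < k)%N -> prime p ->
  #|residues k p n|%:R * (p%:R^-1 ^+ k.-1 * p%:R `^ (- s))
  <= k%:R * p%:R `^ (- (1 + s)) :> R.
Proof.
move=> k1 pp; have p0 : 0 < p%:R :> R by rewrite ltr0n prime_gt0.
rewrite opprD powRD ?(gt_eqF p0) ?implybT // powR_inv1 ?(ltW p0) //.
rewrite mulrA [leRHS]mulrA ler_wpM2r ?powR_ge0 //.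
rewrite exprVn ler_pdivrMr ?exprn_gt0 // -mulrA.
case: k k1 => [|[|k]] // k1; rewrite exprS /= mulKf ?gt_eqF //.
rewrite -natrX -natrM ler_nat.
by have := residues_prime_le pp n k1; rewrite subn2.
Qed.

Lemma A_approx (R : realType) (k n N : nat) (s : R) :
  (1 < k)%N -> (0 < n < N)%N -> 0 < s <= 1 ->
  `| (A k n)%:R - \prod_(p < N | prime p) (1 - #|residues k p n|%:R / p%:R ^+ k)
                  * (n%:R ^+ k / k`!%:R) |
  <= k%:R ^+ k / k`!%:R * (n%:R ^+ k.-1 * n%:R `^ s) * (1 + s^-1) ^+ k :> R.
Proof.
move=> k1 /andP[n0 nN] /andP[s0 s1].
have n0R : 0 < n%:R :> R by rewrite ltr0n.
rewrite (sieve R k nN).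
rewrite -(sum_prime_sets N (fun p => - (#|residues k p n|%:R / p%:R ^+ k))).
rewrite mulr_suml -sumrB.
(* Over the primes of J these multiply to G(d) d^(-(k-1)-s), the d-dependent part of the error for
   d. *)
pose c p : R := #|residues k p n|%:R * (p%:R^-1 ^+ k.-1 * p%:R `^ (- s)).
apply: (@le_trans _ _ (\sum_(J : {set 'I_N} | [forall p in J, prime p])
  k%:R ^+ k / k`!%:R * (n%:R ^+ k.-1 * n%:R `^ s) * \prod_(p in J) c p)).
  apply: le_trans (ler_norm_sum _ _ _) _; apply: ler_sum => J Jp.
  have d0 := prime_set_prod_gt0 Jp.
  have d0R : 0 < (\prod_(p in J) p)%N%:R :> R by rewrite ltr0n.
  rewrite prodrN -[X in _ - X]mulrA -mulrBr normrM normrX normrN1 expr1n mul1r.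
  have s01 : 0 <= s <= 1 by rewrite (ltW s0).
  have := card_divisible_sols_approx k1 d0 n0 s01.
  rewrite powRM ?invr_ge0 ?ler0n //.
  set d := (\prod_(p in J) p)%N in d0 d0R *.
  have -> : d%:R^-1 `^ s = \prod_(p in J) p%:R `^ (- s).
    rewrite -powR_inv1 ?ltW // -powRrM mulN1r natr_prod.
    by rewrite powR_prod.
  have GE : #|residues k d n|%:R = \prod_(p in J) #|residues k p n|%:R :> R.
    by rewrite residues_prime_set // natr_prod.
  have dX j : d%:R^-1 ^+ j = \prod_(p in J) p%:R^-1 ^+ j :> R.
    by rewrite prodrXl prodfV natr_prod.
  rewrite !exprMn !dX GE.
  have -> : \prod_(p in J) (#|residues k p n|%:R / p%:R ^+ k)
     = \prod_(p in J) #|residues k p n|%:R * \prod_(p in J) (p%:R^-1 ^+ k) :> R.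
    by rewrite -big_split; apply: eq_bigr => p _; rewrite exprVn.
  rewrite !big_split /=.
  set x1 := \prod_(p in J) _; set x2 := \prod_(p in J) _.
  set x3 := \prod_(p in J) _; set x4 := \prod_(p in J) _.
  have -> : x1 * (n%:R ^+ k * x2 / k`!%:R) = x1 * x2 * (n%:R ^+ k / k`!%:R).
    by ring.
  move/le_trans; apply; rewrite le_eqVlt; apply/orP; left; apply/eqP; ring.
rewrite -mulr_sumr sum_prime_sets.
rewrite ler_wpM2l ?mulr_ge0 ?invr_ge0 ?exprn_ge0 ?powR_ge0 ?ler0n //.
(* Bernoulli's inequality turns 1 + k p^(-1-s) into a k-th power of an Euler factor. *)
apply: (@le_trans _ _ (\prod_(p < N | prime p) (1 + p%:R `^ (- (1 + s))) ^+ k)).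
  apply: ler_prod => p pp.
  have c0 : 0 <= c p
    by rewrite /c !mulr_ge0 ?exprn_ge0 ?invr_ge0 ?powR_ge0 ?ler0n.
  rewrite addr_ge0 //= (le_trans _ (bernoulli_le _ _)) ?powR_ge0 //.
  by rewrite lerD2l local_weight_le.
rewrite prodrXl lerXn2r ?nnegrE ?euler_product_le //.
  by apply: prodr_ge0 => p _; rewrite addr_ge0 ?powR_ge0.
by rewrite addr_ge0 ?invr_ge0 ?ltW.
Qed.

(** * The local factors of the main term *)

(** Keeps the denominators in [f] nonzero. As (p - 1)^k >= 1, the numerator of psi is at most p^k,
    and it is then divided by p. *)
Lemma psi_lt (R : realType) (k p : nat) : prime p ->
  psi k (p%:R : R) < p%:R ^+ k.
Proof.
move=> pp; have : 2 <= p%:R :> R by rewrite (ler_nat _ 2) prime_gt1.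
move: (p%:R : R) => x x2; rewrite /psi ltr_pdivrMr; last by lra.
have y1 : 1 <= (x - 1) ^+ k by apply: exprn_ege1; lra.
have x1 : 1 <= x ^+ k by apply: exprn_ege1; lra.
have sgn : (-1) ^+ k <= 1 :> R.
  by rewrite -signr_odd; case: odd; rewrite ?expr0 ?expr1; lra.
by nra.
Qed.

Lemma residues_prime_psi (R : realType) (k p n : nat) : (0 < k)%N -> prime p ->
  #|residues k p n|%:R = psi k p%:R - (-1) ^+ k * (p %| n)%N%:R :> R.
Proof.
move=> k0 pp; have p0 : p%:R != 0 :> R by rewrite pnatr_eq0 -lt0n prime_gt0.
apply: (mulfI p0); rewrite residues_prime // mulrBr /psi.
by rewrite [p%:R * (_ / _)]mulrC divfK // [p%:R * (_ * _)]mulrCA.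
Qed.

Lemma local_factor (R : realType) (k p n : nat) : (0 < k)%N -> prime p ->
  1 - #|residues k p n|%:R / p%:R ^+ k
  = (1 - psi k p%:R / p%:R ^+ k)
    * (if (p %| n)%N then 1 + (-1) ^+ k / (p%:R ^+ k - psi k p%:R) else 1) :> R.
Proof.
move=> k0 pp; have pk : p%:R ^+ k != 0 :> R.
  by rewrite expf_neq0 // pnatr_eq0 -lt0n prime_gt0.
have := psi_lt R k pp; rewrite -subr_gt0 => /gt_eqF/negbT hpsi.
rewrite residues_prime_psi //.
case: (p %| n)%N; last by rewrite mulr0 subr0 mulr1.
rewrite mulr1; move: (_ ^+ k) (_ ^+ k) (psi _ _) pk hpsi => e x y x0 xy.
by field; rewrite xy x0.
Qed.

Lemma prod_primes_dvd (R : comNzRingType) (n N : nat) (F : nat -> R) :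
  (0 < n < N)%N ->
  \prod_(p <- primes n) F p = \prod_(p < N | prime p && (p %| n)%N) F p.
Proof.
move=> /andP[n0 nN].
rewrite -(big_mkord (fun p => prime p && (p %| n)%N)) -[RHS]big_filter.
apply: perm_big; apply: uniq_perm;
  rewrite ?primes_uniq ?filter_uniq ?iota_uniq //.
move=> p; rewrite mem_primes mem_filter mem_index_iota n0 /=.
case: prime => //=; case: (boolP (p %| n)%N) => //= pn.
by rewrite (leq_ltn_trans (dvdn_leq n0 pn)).
Qed.

Lemma prod_local_factors (R : realType) (k n N : nat) :
  (0 < k)%N -> (0 < n < N)%N ->
  \prod_(p < N | prime p) (1 - #|residues k p n|%:R / p%:R ^+ k)
  = Cpartial k N * f k n :> R.
Proof.
move=> k0 nN; rewrite /f (prod_primes_dvd _ nN) /Cpartial big_mkord.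
rewrite [X in _ * X]big_mkcondr -big_split /=; apply: eq_bigr => p pp.
exact: local_factor.
Qed.

Lemma psi1 (R : realType) (x : R) : psi 1 x = 0.
Proof.
have -> : psi 1 x = (x ^+ 1 - (x - 1) ^+ 1 + (-1) ^+ 1) / x by [].
by rewrite !expr1 opprB addrCA subrr addr0 subrr mul0r.
Qed.

Lemma C1 (R : realType) : C 1 = 1 :> R.
Proof.
rewrite /C; suff -> : Cpartial 1 = fun=> 1 :> R by exact: lim_cst.
apply/funext => N; rewrite /Cpartial big1 // => p pp.
by rewrite psi1 mul0r subr0.
Qed.

(** Since psi_1 = 0, the factors of [f 1 n] are 1 - 1/p: Euler's product for the totient. *)
Lemma totient_f1 (R : realType) (n : nat) : (0 < n)%N ->
  f 1 n * n%:R = (totient n)%:R :> R.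
Proof.
move=> n0; rewrite totientE // natr_prod.
rewrite [X in _ * X%:R](prod_prime_decomp n0) prime_decompE big_map natr_prod.
rewrite -big_split big_seq [RHS]big_seq; apply: eq_bigr => p /=.
rewrite -logn_gt0; set l := logn p n; rewrite /= => l0.
have : p \in primes n by rewrite -logn_gt0.
rewrite mem_primes => /andP[pp _].
have p0 : p%:R != 0 :> R by rewrite pnatr_eq0 -lt0n prime_gt0.
rewrite -{1}(prednK l0) expnS !natrM mulrA; congr (_ * _).
rewrite psi1 subr0 !expr1 -subn1 natrB ?prime_gt0 //.
by field.
Qed.

(** K does not depend on N, so the bound survives the limit of [Cpartial]. *)
Lemma A_approx_lim (R : realType) (k n : nat) (K : R) :
  (0 < k)%N -> (0 < n)%N ->
  (forall N, (n < N)%N ->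
   `| (A k n)%:R
      - \prod_(p < N | prime p) (1 - #|residues k p n|%:R / p%:R ^+ k)
        * (n%:R ^+ k / k`!%:R) | <= K) ->
  `| (A k n)%:R - C k * f k n * (n%:R ^+ k / k`!%:R) | <= K.
Proof.
move=> k0 n0 h.
pose u N : R := `| (A k n)%:R - Cpartial k N * f k n * (n%:R ^+ k / k`!%:R) |.
have ucvg : (u N @[N --> \oo] -->
    `| (A k n)%:R - C k * f k n * (n%:R ^+ k / k`!%:R) |)%classic.
  apply: cvg_norm; apply: cvgB; first exact: cvg_cst.
  by do 2! apply: cvgMl; exact: Cpartial_is_cvg.
rewrite -(cvg_lim _ ucvg) //; apply: limr_le.
  by apply/cvg_ex; eexists; exact: ucvg.
exists n.+1 => // N /= nN.
by rewrite /u -prod_local_factors ?n0 // h.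
Qed.

(** * Comparison with the stated error term *)

Lemma expR1_bounds (R : realType) : 53 / 20 <= (expR 1 : R) <= 14 / 5.
Proof.
have sq (x a b : R) : 0 <= a -> b <= a ^+ 2 ->
    a <= expR x -> b <= expR (x *+ 2).
  move=> a0 ba ax; rewrite mulr2n expRD -expr2 (le_trans ba) //.
  by rewrite lerXn2r ?nnegrE ?expR_ge0.
(* Five squarings of [1 + y / 32 <= expR (y / 32)], rounding down each time. *)
have h (y a1 a2 a3 a4 a5 : R) : 0 <= 1 + y / 32 ->
    0 <= a1 -> 0 <= a2 -> 0 <= a3 -> 0 <= a4 ->
    a1 <= (1 + y / 32) ^+ 2 -> a2 <= a1 ^+ 2 -> a3 <= a2 ^+ 2 ->
    a4 <= a3 ^+ 2 -> a5 <= a4 ^+ 2 -> a5 <= expR y.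
  move=> h0 h1 h2 h3 h4 g1 g2 g3 g4 g5.
  have -> : y = y / 32 *+ 2 *+ 2 *+ 2 *+ 2 *+ 2.
    by rewrite !mulr2n; lra.
  apply: (sq _ a4 _ h4 g5); apply: (sq _ a3 _ h3 g4); apply: (sq _ a2 _ h2 g3).
  by apply: (sq _ a1 _ h1 g2); apply: (sq _ _ _ h0 g1); exact: expR_ge1Dx.
apply/andP; split.
  by apply: (h 1 (10634 / 10000) (11308 / 10000) (12787 / 10000) (1635 / 1000));
    rewrite ?expr2; lra.
(* The upper bound on e comes from inverting a lower bound on 1/e. *)
have : 361 / 1000 <= expR (-1) :> R.
  by apply: (h (-1) (9384 / 10000) (8805 / 10000) (7752 / 10000) (6009 / 10000));
    rewrite ?expr2; lra.
rewrite expRN -[X in _ -> X <= _]invrK => h1.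
by rewrite -[leRHS]invrK lef_pV2 ?posrE ?invr_gt0 ?expR_gt0 //; lra.
Qed.

(** e^4 <= (14/5)^4 < 64 = 4^3. The threshold 4/3 is where 1 + L <= (7/4) L begins. *)
Lemma ln_ge_4_3 (R : realType) (n : nat) : (4 <= n)%N -> 4 / 3 <= ln n%:R :> R.
Proof.
move=> n4; have /andP[_ e1] := expR1_bounds R.
have n0 : 0 < n%:R :> R by rewrite ltr0n (leq_trans _ n4).
rewrite -ler_expR lnK ?posrE //.
rewrite (@le_trans _ _ 4) ?(ler_nat _ 4) //.
rewrite -(@ler_pXn2r _ 3) ?nnegrE ?expR_ge0 // -expRM_natr divfK //.
have -> : expR 4 = expR 1 ^+ 4 :> R by rewrite -expRM_natr mul1r.
rewrite (@le_trans _ _ ((14 / 5) ^+ 4)) ?lerXn2r ?nnegrE ?expR_ge0 //.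
by lra.
Qed.

(** The left side is one term of the exponential series at k. *)
Lemma pow_div_fact_le (R : realType) (k : nat) :
  k%:R ^+ k / k`!%:R <= expR 1 ^+ k :> R.
Proof.
case: k => [|k]; first by rewrite !expr0 fact0 divr1.
rewrite -expRM_natr mul1r (le_trans _ (expR_ge1Dxn k (ler0n R k.+1))) //.
by rewrite lerDr.
Qed.

(** With q = e, this is what remains of the final comparison once the powers of n and ln n
    cancel. *)
Lemma exp_growth (R : realFieldType) (q : R) (k : nat) :
  53 / 20 <= q -> (1 < k)%N ->
  q * (k%:R + 2) * (7 / 4) ^+ k <= (2 + q) * q ^+ k.
Proof.
move=> q0; elim: k => // -[|[|k]] // IHk _.
  (* At k = 2 the claim is 49/4 <= (2 + q) q, which 53/20 satisfies narrowly. *)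
  by rewrite !expr2; nra.
have {IHk} := IHk isT; rewrite [(7 / 4) ^+ k.+3]exprS [q ^+ k.+3]exprS.
have : 0 <= (7 / 4) ^+ k.+2 :> R by rewrite exprn_ge0 //; lra.
rewrite -[k.+3%:R]natr1; have : 2 <= k.+2%:R :> R by rewrite (ler_nat _ 2).
move: (k.+2%:R) ((7 / 4) ^+ k.+2) (q ^+ k.+2) => K x y K2 x0 IHk.
have -> : (2 + q) * (q * y) = q * ((2 + q) * y) by ring.
have q1 : 0 <= q by lra.
apply: le_trans (ler_wpM2l q1 IHk).
have : 0 <= q * x * (q * (K + 2) - 7 / 4 * (K + 3)).
  rewrite !mulr_ge0 // subr_ge0; nra.
by lra.
Qed.

(** As pi < 4, 2 pi k <= 8 k <= (k + 2)^2. *)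
Lemma sqrt_2pik_le (R : realType) (k : nat) :
  Num.sqrt (2 * pi * k%:R) <= k%:R + 2 :> R.
Proof.
have k0 := ler0n R k; have pi4 := pihalf_lt2 R.
rewrite -[leRHS]ger0_norm ?addr_ge0 // -sqrtr_sqr ler_wsqrtr //.
have : 0 <= (k%:R - 2) ^+ 2 :> R by rewrite sqr_ge0.
have : 0 <= (2 - pi / 2) * k%:R :> R by rewrite mulr_ge0 //; lra.
by rewrite !expr2; lra.
Qed.

Lemma error_term_le (R : realType) (k n : nat) : (1 < k)%N -> (k + 1 < n)%N ->
  k%:R ^+ k / k`!%:R * (n%:R ^+ k.-1 * n%:R `^ (ln n%:R)^-1)
    * (1 + (ln n%:R)^-1^-1) ^+ k
  <= (2 + expR 1) / Num.sqrt (2 * pi * k%:R)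
     * (expR 1 ^+ 2 * ln n%:R) ^+ k * n%:R ^+ (k - 1)%N :> R.
Proof.
move=> k1 kn; have n4 : (4 <= n)%N by lia.
have L43 := ln_ge_4_3 R n4; set L : R := ln n%:R in L43 *.
have L0 : 0 < L by lra.
have n0 : 0 < n%:R :> R by rewrite ltr0n; lia.
have k0 : 0 < k%:R :> R by rewrite ltr0n; lia.
(* With s = 1 / log n, Rankin's factor n^s is exactly e. *)
have ne : n%:R `^ L^-1 = expR 1 :> R.
  by rewrite -[n%:R]lnK ?posrE // -/L -expRM mulfV // gt_eqF.
rewrite ne invrK subn1 [leRHS]mulrC.
set F : R := k%:R ^+ k / _; set Y : R := n%:R ^+ k.-1.
have -> : F * (Y * expR 1) * (1 + L) ^+ k
  = Y * (F * expR 1 * (1 + L) ^+ k) by ring.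
rewrite ler_wpM2l ?exprn_ge0 ?ler0n //.
have /andP[e0 _] := expR1_bounds R.
have S0 : 0 < Num.sqrt (2 * pi * k%:R) :> R
  by rewrite sqrtr_gt0 !mulr_gt0 ?pi_gt0.
have Sle := sqrt_2pik_le R k.
have growth := exp_growth e0 k1.
have fle := pow_div_fact_le R k.
set q : R := expR 1 in e0 growth fle *; set S := Num.sqrt _ in S0 Sle *.
have q0 : 0 < q by lra.
rewrite [leRHS]mulrAC ler_pdivlMr //.
have hL : (1 + L) ^+ k <= (7 / 4 * L) ^+ k by rewrite lerXn2r ?nnegrE //; lra.
have F0 : 0 <= F by rewrite /F divr_ge0 ?exprn_ge0 ?ler0n.
apply: (@le_trans _ _ (q ^+ k * q * (7 / 4 * L) ^+ k * (k%:R + 2))).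
  have L1 : 0 <= 1 + L by lra.
  apply: ler_pM => //; first by rewrite !mulr_ge0 ?exprn_ge0 // ltW.
    exact: ltW.
  apply: ler_pM => //; first by rewrite !mulr_ge0 // ltW.
    by rewrite exprn_ge0.
  by rewrite ler_wpM2r // ltW.
rewrite [(7 / 4 * L) ^+ k]exprMn [(q ^+ 2 * L) ^+ k]exprMn.
rewrite -exprM mulnC exprM expr2.
have : 0 <= q ^+ k * L ^+ k by rewrite mulr_ge0 ?exprn_ge0 ?ltW.
move/ler_wpM2l => /(_ _ _ growth).
suff -> : q ^+ k * L ^+ k * (q * (k%:R + 2) * (7 / 4) ^+ k)
  = q ^+ k * q * ((7 / 4) ^+ k * L ^+ k) * (k%:R + 2).
  move/le_trans; apply; rewrite le_eqVlt; apply/orP; left; apply/eqP; ring.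
ring.
Qed.

Theorem theorem2 (R : realType) (k n : nat) (hk : (1 <= k)%N)
    (hn : (k + 1 < n)%N) :
  `| (A k n)%:R - C k * f k n * (n%:R ^+ k / k`!%:R) |
  <= (2 + expR 1) / Num.sqrt (2 * pi * k%:R)
     * (expR 1 ^+ 2 * ln n%:R) ^+ k * n%:R ^+ (k - 1)%N :> R.
Proof.
have n0 : (0 < n)%N by apply: leq_trans hn.
(* For k = 1 both terms equal the totient of n, so the difference is 0. *)
have [k1|k1] := ltnP 1 k; last first.
  have -> : k = 1%N by apply/eqP; rewrite eqn_leq k1.
  rewrite C1 mul1r expr1 -[(1`!)%N]/1%N divr1 totient_f1 //.
  rewrite A1_totient; last first.
    by rewrite (leq_trans _ hn) // addn1 ltnS.
  rewrite subrr normr0 expr1.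
  by rewrite !mulr_ge0 ?invr_ge0 ?sqrtr_ge0 ?exprn_ge0 ?expR_ge0 ?ln_ge0 ?ler1n.
apply: le_trans (error_term_le R k1 hn); apply: A_approx_lim => // N nN.
have L1 : 4 / 3 <= ln n%:R :> R by apply: ln_ge_4_3; lia.
apply: A_approx => //; first by rewrite n0.
by rewrite invr_gt0 invf_le1; lra.
Qed.
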